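(* Let $a \in C^1(\mathbb{R})$ be strictly convex and increasing with $a(0)=0$, let $F(v)=\int_0^v a(\xi)\,d\xi$, and let $$K_a = \left\{\begin{bmatrix} a(v) & u\\ u & v\\ a(v)u & \frac{1}{2}u^2 + F(v)\end{bmatrix} : u,v \in \mathbb{R}\right\} \subset \mathbb{R}^{3\times 2}.$$ Then $K_a$ does not contain $T_4$ configurations, i.e. there is no ordered set of four distinct matrices $X_1,X_2,X_3,X_4 \in K_a$ that induces a $T_4$ configuration.
   Context: An ordered set of $N$ distinct matrices $\{X_1,\dots,X_N\} \subset \mathbb{R}^{m\times n}$ is said to induce a $T_N$ configuration if there exist matrices $Q, D_1,\dots,D_N \in \mathbb{R}^{m\times n}$ and real numbers $k_1,\dots,k_N>1$ such that (i) $\operatorname{rank}(D_i)\le 1$ for each $i$; (ii) $\sum_{i=1}^N D_i = 0$; (iii) $X_i = Q + \sum_{j=1}^{i-1} D_j + k_i D_i$ for all $1\le i\le N$. *)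

(* Defs.v *)
From HB Require Import structures.
From mathcomp Require Import all_boot all_order all_algebra.
From mathcomp Require Import all_classical all_reals all_analysis.

Set Implicit Arguments.
Unset Strict Implicit.
Unset Printing Implicit Defensive.

Import Order.TTheory GRing.Theory Num.Theory.
Import numFieldNormedType.Exports.

Local Open Scope classical_set_scope.
Local Open Scope ring_scope.

(* An ordered family of N distinct m x n matrices; the indices 1, ..., N of the
   usual definition are shifted to 0, ..., N - 1. *)
Definition induces_TN (R : realType) (m n N : nat)
    (X : 'I_N -> 'M[R]_(m, n)) : Prop :=
  injective X /\
  exists (Q : 'M[R]_(m, n)) (D : 'I_N -> 'M[R]_(m, n)) (k : 'I_N -> R),
    [/\ forall i, 1 < k i,
        forall i, (\rank (D i) <= 1)%N,
        \sum_(i < N) D i = 0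
      & forall i, X i = Q + \sum_(j < N | (j < i)%N) D j + k i *: D i].

Definition C1 (R : realType) (f : R -> R) : Prop :=
  (forall x, derivable f x 1) /\ continuous (f^`())%classic.

Definition strictly_convex (R : realType) (f : R -> R) : Prop :=
  forall x y t : R, x != y -> 0 < t < 1 ->
    f (t * x + (1 - t) * y) < t * f x + (1 - t) * f y.

(* The oriented integral of f from 0 to v: for v < 0 it is minus the integral
   over [v, 0]. *)
Definition primitive0 (R : realType) (f : R -> R) (v : R) : R :=
  if 0 <= v then \int[lebesgue_measure]_(x in `[0, v]) f x
  else - \int[lebesgue_measure]_(x in `[v, 0]) f x.

Definition Ka_mx (R : realType) (a : R -> R) (u v : R) : 'M[R]_(3, 2) :=
  \matrix_(i < 3, j < 2)
    nth 0 (nth [::] [:: [:: a v; u];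
                        [:: u; v];
                        [:: a v * u; 2^-1 * u ^+ 2 + primitive0 a v]] i) j.

Definition Ka (R : realType) (a : R -> R) : set 'M[R]_(3, 2) :=
  [set M | exists u v : R, M = Ka_mx a u v].

(* Main.v *)
Require Import Defs.
From HB Require Import structures.
From mathcomp Require Import all_boot all_order all_algebra.
From mathcomp Require Import all_classical all_reals all_analysis.
From mathcomp Require Import ring lra zify.
Import Order.TTheory GRing.Theory Num.Theory.
Import numFieldNormedType.Exports.
Local Open Scope classical_set_scope.
Local Open Scope ring_scope.

(* Write D_i = c_i n_i with columns c_i and rows n_i. Since the D_i sum to 0,
   the 3 x 4 matrix of the c_i times the 4 x 2 matrix of the n_i vanishes, so
   their ranks cannot be 3 and 2: either some z != 0 has D_i z = 0 for all i, or
   some e != 0 has e D_i = 0 for all i, and accordingly X_i z or e X_i does not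
   depend on i.

   In the first case X_i - X_j has rank at most 1, which on K_a forces equality
   in the trapezoidal rule for the strictly convex function a.

   In the second case let e = (al, be, ga). If ga = 0, the X_i are determined by
   the v_i and the points (v_i, a(v_i)) lie on a line, so there are at most two.
   If ga != 0, put b = a + be/ga, U = u + al/ga and let B be a primitive of b;
   then b U and U^2/2 + B are constant on the X_i, and the upper 2 x 2 minor
   d_ij of X_i - X_j satisfies
     (b_i + b_j) d_ij = (b_i - b_j) ((b_i + b_j)(v_i - v_j) - 2 (B_i - B_j)),
   which is positive by the trapezoidal rule when v_i != v_j. For i maximizing
   |b_i| all d_ij (j != i) thus have the sign of b_i. But a minor is affine along
   rank-one lines and the points P_j = Q + sum_(l < j) D_l form a loop in which
   P_(j+1) lies strictly between P_j and X_j: starting from d(P_(i+1) - X_i) = 0,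
   the minor becomes nonzero and cannot return to d(P_i - X_i) = 0. *)

(** * Primitives and the strict trapezoidal rule *)

Section primitive.
Variable R : realType.
Notation mu := lebesgue_measure.
Implicit Types f : R -> R.

Lemma continuous_itv_integrable f (x y : R) : continuous f ->
  mu.-integrable `[x, y] (EFin \o f).
Proof.
move=> cf; apply: continuous_compact_integrable; first exact: segment_compact.
exact: continuous_subspaceT.
Qed.

Lemma Rintegral_itv_cat f (x y z : R) : continuous f -> x <= y -> y <= z ->
  \int[mu]_(t in `[x, z]) f t =
  \int[mu]_(t in `[x, y]) f t + \int[mu]_(t in `[y, z]) f t.
Proof.
move=> cf xy yz.
have := @Rintegral_itvB R f (BLeft x) (BRight z) y
  (continuous_itv_integrable _ x z cf).
rewrite !bnd_simp => /(_ xy yz) E.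
rewrite -(@Rintegral_itv_obnd_cbnd R y); first by rewrite -E addrC subrK.
apply: integrableS (continuous_itv_integrable _ y z cf) => //.
by apply: subset_itvr; rewrite bnd_simp.
Qed.

Lemma primitive0B f (x y : R) : continuous f -> x <= y ->
  primitive0 f y - primitive0 f x = \int[mu]_(t in `[x, y]) f t.
Proof.
move=> cf xy; rewrite /primitive0.
case: (leP 0 x) => x0; case: (leP 0 y) => y0.
- by rewrite (@Rintegral_itv_cat f 0 x y)// addrC addKr.
- by lra.
- by rewrite (@Rintegral_itv_cat f x 0 y) ?(ltW x0)// opprK addrC.
- by rewrite (@Rintegral_itv_cat f x y 0) ?(ltW y0)// opprK addrC addrK.
Qed.

Lemma strictly_convex_chord f (x y z : R) : strictly_convex f ->
  x < y -> y < z -> (f y - f x) * (z - y) < (f z - f y) * (y - x).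
Proof.
move=> cvx xy yz.
have zx : 0 < z - x by lra.
have := cvx x z ((z - y) / (z - x)).
have -> : (z - y) / (z - x) * x + (1 - (z - y) / (z - x)) * z = y.
  by field; rewrite gt_eqF.
have -> : x != z by rewrite lt_eqF//; lra.
rewrite divr_gt0 ?ltr_pdivrMr ?mul1r//; last lra.
have -> : z - y < z - x by lra.
move=> /(_ isT isT); rewrite -(ltr_pM2r zx).
have -> : ((z - y) / (z - x) * f x + (1 - (z - y) / (z - x)) * f z) * (z - x)
  = (z - y) * f x + (y - x) * f z.
  by field; rewrite gt_eqF.
lra.
Qed.

(** The mean value theorem writes half the gap as [y - x] times the height, at some interior point,
    of the chord above [f]; strict convexity makes that height positive. *)
Lemma strictly_convex_trapezoid f (x y : R) : continuous f ->
  strictly_convex f -> x < y ->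
  2 * (primitive0 f y - primitive0 f x) < (f x + f y) * (y - x).
Proof.
move=> cf cvx xy; rewrite primitive0B ?(ltW xy)//.
pose m := (f y - f x) / (y - x).
(* Starting at [x - 1] puts [x] inside the domain, so [F] has a two-sided derivative at [x] too. *)
pose F t := \int[mu]_(s in `[x - 1, t]) f s.
(* The first two terms integrate the chord from [x] to [t]; [dh] is the chord minus [f]. *)
pose h t := f x * (t - x) + m / 2 * (t - x) ^+ 2 - F t.
pose dh t := f x + m * (t - x) - f t.
have dF t : x - 1 < t -> is_derive t 1 F (f t).
  move=> xt; have [|dF <-] := @continuous_FTC1_closed R f (x - 1) t (t + 1) _
    (continuous_itv_integrable _ (x - 1) (t + 1) cf) xt (cf t); first lra.
  by rewrite derive1E; exact: DeriveDef.
have dhE t : x <= t -> is_derive t 1 h (dh t).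
  move=> xt; have dFt : is_derive t 1 F (f t) by apply: dF; lra.
  by rewrite /h; apply: is_derive_eq; rewrite /dh /GRing.scale/=; field.
have [||c] := @MVT R h dh x y xy.
- by move=> t; rewrite in_itv/= => /andP[xt _]; apply: dhE; exact: ltW.
- apply: derivable_within_continuous => t; rewrite in_itv/= => /andP[xt _].
  by have [] := dhE t xt.
rewrite in_itv/= => /andP[xc cy].
have -> : h y - h x = (f x + f y) * (y - x) / 2 - (F y - F x).
  by rewrite /h /m; field; rewrite gt_eqF// subr_gt0.
have -> : F y - F x = \int[mu]_(t in `[x, y]) f t.
  by rewrite /F (@Rintegral_itv_cat f (x - 1) x y) ?(ltW xy) ?gerBl//
    addrC addKr.
have : 0 < dh c * (y - x).
  have := strictly_convex_chord f x c y cvx xc cy.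
  have -> : dh c * (y - x) = (f y - f c) * (c - x) - (f c - f x) * (y - c).
    by rewrite /dh /m; field; rewrite gt_eqF// subr_gt0.
  by rewrite subr_gt0.
lra.
Qed.

End primitive.

(** * Rank-one matrices and common annihilators *)

Section rank_one.
Variable F : fieldType.

Lemma mxrank_le1_factor (m n : nat) (D : 'M[F]_(m, n)) : (\rank D <= 1)%N ->
  exists (c : 'cV[F]_m) (r : 'rV[F]_n), D = c *m r.
Proof.
move=> rD.
have : (D <= row_base D)%MS by rewrite eq_row_base.
move: (row_base D) rD; case: (\rank D) => [|[|//]] B _ /submxP[c ->].
  by exists 0, 0; rewrite mul0mx [c]thinmx0 mul0mx.
by exists c, B.
Qed.

Lemma mxrank_le1_minor (m n : nat) (D : 'M[F]_(m, n)) i j k l :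
  (\rank D <= 1)%N -> D i j * D k l = D i l * D k j.
Proof.
move=> /mxrank_le1_factor[c [r ->]].
by rewrite !mxE !big_ord1; ring.
Qed.

Lemma exists_row_ker (m n : nat) (A : 'M[F]_(m, n)) : (\rank A < m)%N ->
  exists2 e : 'rV[F]_m, e != 0 & e *m A = 0.
Proof.
move=> rA; have : kermx A != 0 by rewrite kermx_eq0 /row_free neq_ltn rA.
by move=> /rowV0Pn[e /sub_kermxP eA e0]; exists e.
Qed.

Lemma rank1_sum0_annihilator (m n N : nat) (D : 'I_N -> 'M[F]_(m, n)) :
  (N < m + n)%N -> (forall i, (\rank (D i) <= 1)%N) -> \sum_i D i = 0 ->
  (exists2 e : 'rV[F]_m, e != 0 & forall i, e *m D i = 0) \/
  (exists2 z : 'cV[F]_n, z != 0 & forall i, D i *m z = 0).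
Proof.
move=> Nmn rD sD.
have /choice[cr Dcr] : forall i,
    exists cr : 'cV[F]_m * 'rV[F]_n, D i = cr.1 *m cr.2.
  by move=> i; have [c [r ->]] := mxrank_le1_factor _ _ _ (rD i); exists (c, r).
pose c i := (cr i).1; pose r i := (cr i).2.
pose A := \matrix_(s < m, i < N) c i s 0.
pose B := \matrix_(i < N, t < n) r i 0 t.
have AB : A *m B = 0.
  rewrite -sD; apply/matrixP => s t; rewrite !mxE summxE.
  by apply: eq_bigr => i _; rewrite Dcr !mxE big_ord1.
(* The ranks of [A] and [B] add up to at most [N < m + n], so [A] lacks full row rank or [B] lacks
   full column rank. *)
have rAB := mulmx0_rank_max AB.
have [rA|rA] := ltnP (\rank A) m.
  left; have [e e0 eA] := exists_row_ker _ _ A rA; exists e => // i.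
  suff -> : D i = col i A *m r i by rewrite colE !mulmxA eA !mul0mx.
  by rewrite Dcr; congr (_ *m _); apply/colP => s; rewrite !mxE.
right; have [|e e0 eB] := exists_row_ker _ _ B^T.
  by rewrite mxrank_tr; lia.
exists e^T => [|i]; first by rewrite trmx_eq0.
suff -> : D i = c i *m row i B.
  by rewrite -mulmxA -row_mul -[B]trmxK -trmx_mul eB trmx0 row0 mulmx0.
by rewrite Dcr; congr (_ *m _); apply/rowP => t; rewrite !mxE.
Qed.

End rank_one.

(** * Minors along the loop of a T_N configuration *)

Section chain.
Variable R : realFieldType.

(** Each [p j.+1] is a convex combination, with positive weights, of [p j] and [x j]. Starting from
    the zero at [i.+1], positivity propagates through [p N = p 0] and round to [p i], which is
    zero. *)
Lemma barycentric_loop_gt0 (N : nat) (i : nat) (p x k : nat -> R) :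
  (1 < N)%N -> (i < N)%N -> p N = p 0%N -> p i = 0 -> p i.+1 = 0 ->
  (forall j, (j < N)%N -> 1 < k j /\
     k j * p j.+1 = (k j - 1) * p j + x j) ->
  (forall j, (j < N)%N -> j != i -> 0 < x j) -> False.
Proof.
move=> N1 iN pN pi pi1 step x_gt0.
have pos j : (j < N)%N -> j != i -> 0 <= p j -> 0 < p j.+1.
  move=> jN ji pj; have [k1 E] := step j jN; have xj := x_gt0 j jN ji.
  have : 0 < k j * p j.+1.
    by rewrite E ltr_wpDl// mulr_ge0// subr_ge0 ltW.
  by rewrite pmulr_rgt0// (lt_trans _ k1).
have after j : (i.+1 < j)%N -> (j <= N)%N -> 0 < p j.
  elim: j => // j IH ij jN.
  apply: pos => //; first by rewrite gtn_eqF.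
  move: ij; rewrite ltnS leq_eqVlt => /predU1P[<-|ij]; first by rewrite pi1.
  by apply/ltW/IH => //; exact: ltnW.
(* The inequality is weak: if [i] is the last index, then [p 0 = p i.+1 = 0]. *)
have p0 : 0 <= p 0%N.
  rewrite -pN; move: iN; rewrite leq_eqVlt => /predU1P[<-|iN].
    by rewrite pi1.
  by apply/ltW/after.
have before j : (j < i)%N -> 0 < p j.+1.
  elim: j => [|j IH] ji.
    by apply: pos => //; [exact: ltn_trans ji iN|rewrite ltn_eqF].
  apply: pos; [exact: ltn_trans ji iN|by rewrite ltn_eqF|].
  exact/ltW/IH/ltnW.
case: i => [|i] in iN pi pi1 before after x_gt0 pos *.
  by have := after _ N1 (leqnn N); rewrite pN pi ltxx.
by have := before i (ltnSn i); rewrite pi ltxx.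
Qed.

End chain.

Definition minor2 {R : realType} {m n : nat} (r s : 'I_m) (c d : 'I_n)
  (M : 'M[R]_(m, n)) : R := M r c * M s d - M r d * M s c.

(** The minor of [M + t *: D] has no quadratic term in [t], so it is affine; its values at 0, 1 and
    [k] are compared. *)
Lemma minor2_shift (R : realType) (m n : nat) r s c d (M D : 'M[R]_(m, n)) k :
  (\rank D <= 1)%N ->
  k * minor2 r s c d (M + D) =
  (k - 1) * minor2 r s c d M + minor2 r s c d (M + k *: D).
Proof.
move=> /(@mxrank_le1_minor _ _ _ D r c s d) E.
by rewrite /minor2 !mxE; ring: E.
Qed.

Lemma minor2_rank1 (R : realType) (m n : nat) r s c d (D : 'M[R]_(m, n)) k :
  (\rank D <= 1)%N -> minor2 r s c d (k *: D) = 0.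
Proof.
move=> /(@mxrank_le1_minor _ _ _ D r c s d) E.
by rewrite /minor2 !mxE; ring: E.
Qed.

(** The minor of [Y - X i] vanishes at both ends of step [i] of the loop, since [P i - X i] and
    [P i.+1 - X i] are the multiples [- k i] and [1 - k i] of [D i]. *)
Lemma TN_minor2_sign (R : realType) (m n N : nat) (X : 'I_N -> 'M[R]_(m, n))
    r s c d (i : 'I_N) (sg : R) : (1 < N)%N -> induces_TN X ->
  ~ (forall j, j != i -> 0 < sg * minor2 r s c d (X j - X i)).
Proof.
move=> N1 [_ [Q [D [k [k1 rD sD XE]]]]] pos.
pose P (j : nat) : 'M[R]_(m, n) := Q + \sum_(l < N | (l < j)%N) D l.
have PS (j : 'I_N) : P j.+1 = P j + D j.
  rewrite /P -addrA; congr (_ + _); rewrite (bigD1 j)//= addrC; congr (_ + _).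
  apply: eq_bigl => l; rewrite ltnS [RHS]ltn_neqAle andbC.
  by congr (_ && _).
have XP j : X j = P j + k j *: D j by rewrite XE.
(* The default [i] is never met: only indices below [N] are evaluated. *)
pose o j : 'I_N := odflt i (insub j).
have oE (j : 'I_N) : o j = j by rewrite /o valK.
have oK j : (j < N)%N -> o j = j :> nat.
  by move=> jN; rewrite /o insubT.
pose f Y := sg * minor2 r s c d (Y - X i).
apply: (@barycentric_loop_gt0 R N i (f \o P) (fun j => f (X (o j)))
  (fun j => k (o j))) => //=.
- congr f; rewrite /P; congr (_ + _).
  rewrite [RHS]big_pred0// -[RHS]sD; apply: eq_bigl => l.
  by rewrite ltn_ord.
- by rewrite /f XP opprD addrA subrr add0r -scaleNr minor2_rank1 ?mulr0.
- rewrite /f PS XP.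
  have -> : P i + D i - (P i + k i *: D i) = (1 - k i) *: D i.
    by rewrite opprD addrACA subrr add0r scalerBl scale1r.
  by rewrite minor2_rank1 ?mulr0.
- move=> j jN; split=> //.
  have -> : j = o j by rewrite oK.
  rewrite !oE PS [in f (X _)]XP /f mulrCA addrAC minor2_shift//.
  by rewrite mulrDr mulrCA [P _ - _ + _]addrAC.
- move=> j jN ji; apply: pos; apply: contra ji => /eqP <-.
  by rewrite oK.
Qed.

Lemma TN_annihilator (R : realType) (m n N : nat) (X : 'I_N -> 'M[R]_(m, n)) :
  (N < m + n)%N -> induces_TN X ->
  (exists2 e : 'rV[R]_m, e != 0 & forall i j, e *m X i = e *m X j) \/
  (exists2 z : 'cV[R]_n, z != 0 & forall i j, X i *m z = X j *m z).
Proof.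
move=> Nmn [_ [Q [D [k [_ rD sD XE]]]]].
have [[e e0 eD]|[z z0 Dz]] := rank1_sum0_annihilator _ _ _ _ D Nmn rD sD.
- left; exists e => // i j; suff E l : e *m X l = e *m Q by rewrite !E.
  rewrite XE !mulmxDr -scalemxAr eD scaler0 addr0 mulmx_sumr big1 ?addr0//.
- right; exists z => // i j; suff E l : X l *m z = Q *m z by rewrite !E.
  rewrite XE !mulmxDl -scalemxAl Dz scaler0 addr0 mulmx_suml big1 ?addr0//.
Qed.

(* Multiplying the determinant by [bi + bj] eliminates [Ui] and [Uj]. *)
Lemma det_mul_sum (F : fieldType) (bi bj Ui Uj vi vj Bi Bj : F) :
  bi * Ui = bj * Uj -> Ui ^+ 2 + 2 * Bi = Uj ^+ 2 + 2 * Bj ->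
  (bi + bj) * ((bi - bj) * (vi - vj) - (Ui - Uj) ^+ 2) =
  (bi - bj) * ((bi + bj) * (vi - vj) - 2 * (Bi - Bj)).
Proof.
move=> E1 E2; transitivity ((bi - bj) * ((bi + bj) * (vi - vj) - 2 * (Bi - Bj))
  - 2 * (Ui - Uj) * (bi * Ui - bj * Uj)
  + (bi - bj) * (Ui ^+ 2 + 2 * Bi - (Uj ^+ 2 + 2 * Bj))); first by ring.
by rewrite E1 E2 !subrr !mulr0 subr0 addr0.
Qed.

(** * Annihilators of points of K_a *)

Section Ka.
Variables (R : realType) (a : R -> R).
Hypothesis a_cont : continuous a.
Hypothesis a_convex : strictly_convex a.
Hypothesis a_incr : increasing_fun a.
Let F := primitive0 a.

Lemma Ka_mxE u v i j : Ka_mx a u v i j =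
    nth 0 (nth [::] [:: [:: a v; u]; [:: u; v];
      [:: a v * u; 2^-1 * u ^+ 2 + F v]] i) j.
Proof. by rewrite mxE. Qed.

(** Exchanging [x] and [y] flips both factors, so [x < y] may be assumed; then both are negative. *)
Lemma trapezoid_mul_gt0 x y :
  x != y -> 0 < (a x - a y) * ((a x + a y) * (x - y) - 2 * (F x - F y)).
Proof.
wlog xy : x y / x < y => [wlog|_].
  case: (ltgtP x y) => // xy _; first by apply: wlog => //; rewrite lt_eqF.
  have := wlog y x xy; rewrite lt_eqF// => /(_ isT).
  by congr (_ < _); ring.
have := strictly_convex_trapezoid _ a x y a_cont a_convex xy; rewrite -/F.
have := leW_mono a_incr x y; rewrite xy -subr_gt0 => axy T.
rewrite -mulrNN mulr_gt0//; lra.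
Qed.

(** The rows of the difference are all orthogonal to [z], so its 2 x 2 minors vanish. If [v] and
    [v'] differ, these minors force equality in the trapezoidal rule. *)
Lemma Ka_no_right_annihilator u v u' v' (z : 'cV[R]_2) : z != 0 ->
  Ka_mx a u v *m z = Ka_mx a u' v' *m z -> u = u' /\ v = v'.
Proof.
move=> z0 /colP E.
have := E ord0; have := E (lift ord0 ord0).
have := E (lift ord0 (lift ord0 ord0)).
rewrite !mxE !big_ord_recl !big_ord0 !Ka_mxE/= !addr0.
set p := z ord0 _; set q := z (lift _ _) _ => E3 E2 E1.
have pq : (p != 0) || (q != 0).
  apply: contraNT z0; rewrite negb_or !negbK => /andP[/eqP p0 /eqP q0].
  apply/eqP/colP => i; rewrite mxE.
  case: (unliftP ord0 i) => [j ->|->]; last exact: p0.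
  by rewrite (ord1 j).
have det0 x1 y1 x2 y2 : x1 * p + y1 * q = 0 -> x2 * p + y2 * q = 0 ->
    x1 * y2 = x2 * y1.
  move=> e1 e2; apply/eqP; rewrite -subr_eq0.
  have Hp : (x1 * y2 - x2 * y1) * p = 0.
    transitivity ((x1 * p + y1 * q) * y2 - (x2 * p + y2 * q) * y1); first ring.
    by rewrite e1 e2 !mul0r subrr.
  have Hq : (x1 * y2 - x2 * y1) * q = 0.
    transitivity ((x2 * p + y2 * q) * x1 - (x1 * p + y1 * q) * x2); first ring.
    by rewrite e1 e2 !mul0r subrr.
  move: pq => /orP[] nz; rewrite -(mulIr_eq0 _ (mulIf nz)); exact/eqP.
have e1 : (a v - a v') * p + (u - u') * q = 0 by lra.
have e2 : (u - u') * p + (v - v') * q = 0 by lra.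
have e3 : (a v * u - a v' * u') * p
  + (2^-1 * u ^+ 2 + F v - (2^-1 * u' ^+ 2 + F v')) * q = 0 by lra.
have D12 := det0 _ _ _ _ e1 e2; have D23 := det0 _ _ _ _ e2 e3.
have [vv|vv] := eqVneq v v'.
  split=> //; apply/eqP; rewrite -subr_eq0 -sqrf_eq0 expr2 -D12 vv.
  by rewrite !subrr mul0r.
exfalso; have T := trapezoid_mul_gt0 _ _ vv.
have avv : a v - a v' != 0.
  by apply: contraTneq T => ->; rewrite mul0r ltxx.
have uu : u - u' != 0.
  rewrite -sqrf_eq0 expr2 -D12 mulf_neq0// subr_eq0//.
(* Adding [u + u'] times the first minor relation to twice the second cancels every term but the
   trapezoid defect. *)
have : (u - u') * ((a v + a v') * (v - v') - 2 * (F v - F v')) = 0.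
  transitivity (2 * ((a v * u - a v' * u') * (v - v')
      - (u - u') * (2^-1 * u ^+ 2 + F v - (2^-1 * u' ^+ 2 + F v')))
    + (u + u') * ((u - u') * (u - u') - (a v - a v') * (v - v')));
    first by field.
  by rewrite D12 D23 !subrr !mulr0 addr0.
move/eqP; rewrite mulf_eq0 (negPf uu)/= => /eqP E0.
by move: T; rewrite E0 mulr0 ltxx.
Qed.

Section points.
Variables u v : 'I_4 -> R.
Hypothesis uv_inj : forall i j, u i = u j -> v i = v j -> i = j.
Let X i := Ka_mx a (u i) (v i).
Let o1 : 'I_4 := lift ord0 ord0.
Let o2 : 'I_4 := lift ord0 (lift ord0 ord0).

Lemma minor2_Ka i j : minor2 ord0 (lift ord0 ord0) ord0 (lift ord0 ord0)
    (X j - X i) =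
  (a (v j) - a (v i)) * (v j - v i) - (u j - u i) ^+ 2.
Proof. by rewrite /minor2 !mxE/= expr2. Qed.

Lemma no_linear_annihilator (al be : R) : (al != 0) || (be != 0) ->
  (forall i j, al * a (v i) + be * u i = al * a (v j) + be * u j) ->
  (forall i j, al * u i + be * v i = al * u j + be * v j) -> False.
Proof.
move=> nz E1 E2; have [al0|al0] := eqVneq al 0.
  move: nz E1 E2; rewrite al0 eqxx/= => be0 E1 E2.
  have /uv_inj : u ord0 = u o1.
    by have := E1 ord0 o1; rewrite !mul0r !add0r => /(mulfI be0).
  have : v ord0 = v o1.
    by have := E2 ord0 o1; rewrite !mul0r !add0r => /(mulfI be0).
  by move=> -> /(_ erefl).
(* Eliminating [u] gives all chords of [a] the slope [(be / al) ^+ 2], which strict convexity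
   forbids for three distinct abscissas. *)
have slope i j : al ^+ 2 * (a (v i) - a (v j)) = be ^+ 2 * (v i - v j).
  have e1 := E1 i j; have e2 := E2 i j.
  transitivity (al * (al * a (v i) + be * u i - (al * a (v j) + be * u j))
    - be * (al * u i + be * v i - (al * u j + be * v j))
    + be ^+ 2 * (v i - v j)); first by ring.
  by rewrite e1 e2 !subrr; ring.
have v_inj : injective v.
  move=> i j vij; apply: uv_inj => //; have := E2 i j.
  by rewrite vij => /addIr /(mulfI al0).
have al2 : 0 < al ^+ 2 by rewrite exprn_even_gt0.
have no3 i j l : v i < v j -> v j < v l -> False.
  move=> ij jl; have := strictly_convex_chord _ a _ _ _ a_convex ij jl.
  by rewrite -(ltr_pM2l al2) !mulrA !slope mulrAC ltxx.
have ne i j : i != j -> v i != v j by rewrite (inj_eq v_inj).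
have /orP[h1|h1] := lt_total (ne ord0 o1 isT);
have /orP[h2|h2] := lt_total (ne ord0 o2 isT);
have /orP[h3|h3] := lt_total (ne o1 o2 isT);
  solve [exact: (no3 _ _ _ h1 h2)|exact: (no3 _ _ _ h2 h1)|
  exact: (no3 _ _ _ h1 h3)|exact: (no3 _ _ _ h3 h1)|
  exact: (no3 _ _ _ h3 h2)|exact: (no3 _ _ _ h2 h3)].
Qed.

Lemma annihilator_minor2_sign (e : 'rV[R]_3) : e != 0 ->
  (forall i j, e *m X i = e *m X j) ->
  exists (i : 'I_4) (sg : R), forall j, j != i ->
  0 < sg * minor2 ord0 (lift ord0 ord0) ord0 (lift ord0 ord0) (X j - X i).
Proof.
move=> e0 E.
pose al := e ord0 ord0; pose be := e ord0 (lift ord0 ord0).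
pose ga := e ord0 (lift ord0 (lift ord0 ord0)).
have E1 i j : al * a (v i) + be * u i + ga * (a (v i) * u i) =
    al * a (v j) + be * u j + ga * (a (v j) * u j).
  have /rowP/(_ ord0) := E i j.
  by rewrite !mxE !big_ord_recl !big_ord0 !Ka_mxE/= !addr0 !addrA.
have E2 i j : al * u i + be * v i + ga * (2^-1 * u i ^+ 2 + F (v i)) =
    al * u j + be * v j + ga * (2^-1 * u j ^+ 2 + F (v j)).
  have /rowP/(_ (lift ord0 ord0)) := E i j.
  by rewrite !mxE !big_ord_recl !big_ord0 !Ka_mxE/= !addr0 !addrA.
have [ga0|ga0] := eqVneq ga 0.
  exfalso; apply: (@no_linear_annihilator al be).
  - apply: contraNT e0; rewrite negb_or !negbK => /andP[/eqP al0 /eqP be0].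
    apply/eqP/rowP => i; rewrite mxE.
    case: (unliftP ord0 i) => [j ->|->]; last exact: al0.
    case: (unliftP ord0 j) => [l ->|->]; last exact: be0.
    by rewrite (ord1 l).
  - by move=> i j; have := E1 i j; rewrite ga0 !mul0r !addr0.
  - by move=> i j; have := E2 i j; rewrite ga0 !mul0r !addr0.
(* [e X_i] is constant iff [b i * U i] and [U i ^+ 2 / 2 + B i] are. *)
pose b i := a (v i) + be / ga; pose U i := u i + al / ga.
pose B i := F (v i) + be / ga * v i.
have bU i j : b i * U i = b j * U j.
  have e1 := E1 i j; apply: (mulfI ga0); rewrite /b /U.
  transitivity (al * a (v i) + be * u i + ga * (a (v i) * u i) + al * be / ga).
    by field.
  by rewrite e1; field.
have UB i j : U i ^+ 2 + 2 * B i = U j ^+ 2 + 2 * B j.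
  have e2 := E2 i j; apply: (mulfI ga0); rewrite /B /U.
  transitivity (2 * (al * u i + be * v i + ga * (2^-1 * u i ^+ 2 + F (v i)))
    + al ^+ 2 / ga); first by field.
  by rewrite e2; field.
have det i j : (b i + b j) *
    ((a (v i) - a (v j)) * (v i - v j) - (u i - u j) ^+ 2) =
    (a (v i) - a (v j)) * ((a (v i) + a (v j)) * (v i - v j)
     - 2 * (F (v i) - F (v j))).
  have := det_mul_sum R (b i) (b j) (U i) (U j) (v i) (v j) _ _
    (bU i j) (UB i j).
  have -> : b i - b j = a (v i) - a (v j) by rewrite /b; ring.
  have -> : U i - U j = u i - u j by rewrite /U; ring.
  by move=> ->; congr (_ * _); rewrite /b /B; ring.
(* Equal [v] gives equal [b] but distinct [U], so the constancy of [b * U] forces [b i = 0]. *)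
have veq i j : v i = v j -> i != j -> b i = 0.
  move=> vij ij; have uij : u i != u j.
    by apply: contraNneq ij => uij; exact/eqP/uv_inj.
  have bij : b i = b j by rewrite /b vij.
  have := bU i j; rewrite -bij => /eqP; rewrite -subr_eq0 -mulrBr mulf_eq0.
  move=> /orP[/eqP//|]; rewrite /U => /eqP h; case/eqP: uij; lra.
case: (@Order.TotalTheory.arg_maxP _ _ 'I_4 ord0 predT (fun i => `|b i|))
  => //= i _ bmax.
have [bi0|bi0] := eqVneq (b i) 0.
  (* If the maximum is 0, all [v] agree and the [U] are pairwise opposite, impossible for three
     points. *)
  exfalso; have b0 j : b j = 0.
    by apply/eqP; rewrite -normr_le0 -(normr0 R) -bi0; exact: bmax.
  have v0 j l : v j = v l.
    apply: (inc_inj a_incr); have := b0 j; rewrite -(b0 l) /b; exact: addIr.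
  have u0 j l : U j ^+ 2 = U l ^+ 2.
    by have := UB j l; rewrite /B (v0 j l) => /addIr.
  have opp j l : j != l -> U j = - U l.
    move=> jl; have /eqP := u0 j l; rewrite eqf_sqr => /predU1P[|/eqP//].
    by move=> /addIr ujl; case/eqP: jl; exact: uv_inj.
  have o01 := opp ord0 o1 isT; have o02 := opp ord0 o2 isT.
  suff /addIr : U o1 = U o2 by move=> /uv_inj/(_ (v0 _ _)).
  by apply: oppr_inj; rewrite -o01 -o02.
exists i, (b i) => j ji; rewrite minor2_Ka.
have vji : v j != v i.
  apply: contraNneq bi0 => vji; apply/eqP/(veq i j) => //.
  by rewrite eq_sym.
have := trapezoid_mul_gt0 _ _ vji; rewrite -det.
set d := (_ - _ ^+ 2) => pos.
(* By maximality [b j + b i] has the sign of [b i] or is zero; [pos] excludes zero. *)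
have /= := bmax j isT; rewrite ler_norml => /andP[h1 h2].
case: (ltgtP 0 (b i)) => [bi|bi|bi]; last by rewrite -bi eqxx in bi0.
- rewrite gtr0_norm// in h1 h2; rewrite pmulr_rgt0//.
  rewrite -(pmulr_rgt0 _ (_ : 0 < b j + b i))//.
  rewrite lt_neqAle; apply/andP; split; last lra.
  by apply: contraTneq pos => <-; rewrite mul0r ltxx.
- rewrite ltr0_norm// in h1 h2; rewrite nmulr_rgt0//.
  rewrite -(nmulr_rgt0 _ (_ : b j + b i < 0))//.
  rewrite lt_neqAle; apply/andP; split; last lra.
  by apply: contraTneq pos => ->; rewrite mul0r ltxx.
Qed.

End points.

End Ka.

Theorem theorem1p1 (R : realType) (a : R -> R)
    (a_C1 : C1 a) (a_convex : strictly_convex a) (a_incr : increasing_fun a)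
    (a0 : a 0 = 0) :
  ~ exists X : 'I_4 -> 'M[R]_(3, 2), (forall i, Ka a (X i)) /\ induces_TN X.
Proof.
move=> [X [XK TX]].
have a_cont : continuous a.
  by move=> x; apply/differentiable_continuous/derivable1_diffP; case: a_C1.
have /choice[uv XE] : forall i, exists uv : R * R, X i = Ka_mx a uv.1 uv.2.
  by move=> i; have [u [v ->]] := XK i; exists (u, v).
have X_inj : injective X by case: TX.
pose u i := (uv i).1; pose v i := (uv i).2.
have uv_inj i j : u i = u j -> v i = v j -> i = j.
  by move=> uij vij; apply: X_inj; rewrite !XE -/(u _) -/(v _) uij vij.
(* The dimension count is [4 < 3 + 2]. *)
have [//|[e e0 eX]|[z z0 Xz]] := TN_annihilator _ _ _ _ X _ TX.
  have [|i [sg pos]] := annihilator_minor2_sign _ a a_cont a_convex a_incr u v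
    uv_inj e e0.
    by move=> i j; rewrite -!XE.
  apply: (TN_minor2_sign _ _ _ _ X ord0 (lift ord0 ord0) ord0 (lift ord0 ord0)
    i sg) => // j ji.
  by rewrite !XE; exact: pos.
have := Xz ord0 (lift ord0 ord0); rewrite !XE.
move=> /(Ka_no_right_annihilator _ a a_cont a_convex a_incr _ _ _ _ z z0).
move=> [uE vE].
by have := uv_inj _ _ uE vE.
Qed.
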